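(* Let $\mathcal{A}$ be a Hopf algebra with invertible antipode over a field and let $P\in\mathcal{A}$ be a right group-like projection. The following are equivalent: (1) $P$ is a two sided group-like projection; (2) $S^2(\mathcal{N}_P)=\mathcal{N}_P$; (3) $\Delta(P)\in S(\mathcal{N}_P)\otimes\mathcal{N}_P$. Moreover, if $P$ is two sided then $\mathcal{V}_P=\mathcal{N}_P=\mathcal{N}_P^l=\mathcal{N}_P^r$.
   Context: $(\mathcal{A},\Delta,S,\varepsilon)$ is a Hopf algebra over an arbitrary field with invertible antipode $S$ and unit $1$. A projection is an idempotent. A non-zero projection $P\in\mathcal{A}$ is a right group-like projection if $\Delta(P)(1\otimes P)=P\otimes P=(1\otimes P)\Delta(P)$, a left group-like projection if $\Delta(P)(P\otimes 1)=P\otimes P=(P\otimes 1)\Delta(P)$, and a two sided group-like projection if it is both. For a right group-like projection $P$ define $\mathcal{N}^l_P=\{x\in\mathcal{A}:(1\otimes P)\Delta(x)=x\otimes P\}$, $\mathcal{N}^r_P=\{x\in\mathcal{A}:\Delta(x)(1\otimes P)=x\otimes P\}$, $\mathcal{N}_P=\mathcal{N}^l_P\cap\mathcal{N}^r_P$ and $\mathcal{V}_P=\{(\mu\otimes\mathrm{id})(\Delta(P)):\mu\in\mathcal{A}^*\}$. *)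

(* Defs.v *)
From HB Require Import structures.
From mathcomp Require Import all_boot all_algebra.
From mathcomp Require Import boolp classical_sets.
From mathcomp.multinomials Require Import freeg.

Set Implicit Arguments.
Unset Strict Implicit.
Unset Printing Implicit Defensive.

Import GRing.Theory.

Local Open Scope ring_scope.
Local Open Scope quotient_scope.
Local Open Scope classical_set_scope.

Section TensorProduct.
Context (k : fieldType) (U V : lmodType k).

Local Notation free := {freeg (U * V)%type / k}.
Local Notation gen u v := (<< (u, v) >> : free).

(* The span of the bilinearity relations in the free module on U * V. *)
Inductive tensor_rel : free -> Prop :=
| tensor_rel0 : tensor_rel 0
| tensor_relD x y : tensor_rel x -> tensor_rel y -> tensor_rel (x + y)
| tensor_relZ a x : tensor_rel x -> tensor_rel (a *: x)
| tensor_relDl u u' v : tensor_rel (gen (u + u') v - gen u v - gen u' v)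
| tensor_relDr u v v' : tensor_rel (gen u (v + v') - gen u v - gen u v')
| tensor_relZl a u v : tensor_rel (gen (a *: u) v - a *: gen u v)
| tensor_relZr a u v : tensor_rel (gen u (a *: v) - a *: gen u v).

Definition tensor_relb (x : free) : bool := `[< tensor_rel x >].

Lemma tensor_rel_zmod_closed : zmod_closed tensor_relb.
Proof.
split=> [|x y /asboolP rx /asboolP ry]; apply/asboolP.
  exact: tensor_rel0.
by rewrite -[- y]scaleN1r; apply: tensor_relD => //; apply: tensor_relZ.
Qed.

HB.instance Definition _ :=
  GRing.isZmodClosed.Build free tensor_relb tensor_rel_zmod_closed.

Definition tensor_rels : zmodClosed free :=
  GRing.ZmodClosed.clone free tensor_relb _.

Definition tensor : Type := Quotient.quot tensor_rels.

HB.instance Definition _ := Choice.on tensor.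
HB.instance Definition _ := GRing.Zmodule.on tensor.

Definition tensor_pi (x : free) : tensor := \pi_(Quotient.quot tensor_rels) x.

Definition tens (u : U) (v : V) : tensor := tensor_pi (gen u v).

Definition tensor_scale (a : k) (t : tensor) : tensor :=
  tensor_pi (a *: repr (t : Quotient.quot tensor_rels)).

Fact tensor_pi_eq x y : tensor_rel (x - y) -> tensor_pi x = tensor_pi y.
Proof.
move=> r; apply/eqP; rewrite /tensor_pi -Quotient.idealrBE.
exact/asboolP.
Qed.

Fact tensor_pi_rel x y : tensor_pi x = tensor_pi y -> tensor_rel (x - y).
Proof.
move=> /eqP; rewrite /tensor_pi -Quotient.idealrBE => r.
exact/asboolP.
Qed.

Fact tensor_piK t : tensor_pi (repr (t : Quotient.quot tensor_rels)) = t.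
Proof. exact: reprK. Qed.

Fact tensor_piD x y : tensor_pi (x + y) = tensor_pi x + tensor_pi y.
Proof. by rewrite /tensor_pi raddfD. Qed.

Fact tensor_piZ a x : tensor_pi (a *: x) = tensor_scale a (tensor_pi x).
Proof.
apply: tensor_pi_eq; rewrite -scalerBr; apply: tensor_relZ.
by apply: tensor_pi_rel; rewrite tensor_piK.
Qed.

Fact tensor_scaleA a b t :
  tensor_scale a (tensor_scale b t) = tensor_scale (a * b) t.
Proof. by rewrite -[t]tensor_piK -!tensor_piZ scalerA. Qed.

Fact tensor_scale1 : left_id 1 tensor_scale.
Proof. by move=> t; rewrite -[t]tensor_piK -!tensor_piZ scale1r. Qed.

Fact tensor_scaleDr : right_distributive tensor_scale +%R.
Proof.
move=> a s t; rewrite -[s]tensor_piK -[t]tensor_piK.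
by rewrite -!(tensor_piD, tensor_piZ) scalerDr.
Qed.

Fact tensor_scaleDl t : {morph tensor_scale^~ t : a b / a + b}.
Proof.
by move=> a b; rewrite -[t]tensor_piK -!(tensor_piD, tensor_piZ) scalerDl.
Qed.

HB.instance Definition _ := GRing.Zmodule_isLmodule.Build k tensor
  tensor_scaleA tensor_scale1 tensor_scaleDr tensor_scaleDl.

Fact tensor_pi_linear : linear tensor_pi.
Proof. by move=> a x y; rewrite tensor_piD tensor_piZ. Qed.

HB.instance Definition _ :=
  GRing.isLinear.Build k free tensor *:%R tensor_pi tensor_pi_linear.

Lemma tensDl u u' v : tens (u + u') v = tens u v + tens u' v.
Proof.
rewrite /tens -raddfD; apply: tensor_pi_eq.
by rewrite opprD addrA; apply: tensor_relDl.
Qed.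

Lemma tensDr u v v' : tens u (v + v') = tens u v + tens u v'.
Proof.
rewrite /tens -raddfD; apply: tensor_pi_eq.
by rewrite opprD addrA; apply: tensor_relDr.
Qed.

Lemma tensZl a u v : tens (a *: u) v = a *: tens u v.
Proof. by rewrite /tens -linearZ; apply/tensor_pi_eq/tensor_relZl. Qed.

Lemma tensZr a u v : tens u (a *: v) = a *: tens u v.
Proof. by rewrite /tens -linearZ; apply/tensor_pi_eq/tensor_relZr. Qed.

Lemma tens_bilinear : bilinear_for *:%R *:%R tens.
Proof.
by split=> [v a u u'|u a v v']; rewrite ?tensDl ?tensZl ?tensDr ?tensZr.
Qed.

Lemma tens_spanP t : exists s : seq (U * V), t = \sum_(p <- s) tens p.1 p.2.
Proof.
rewrite -[t]tensor_piK; set x := repr _.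
rewrite -(freeg_sumE x) raddf_sum /=.
exists [seq (coeff p x *: p.1, p.2) | p <- dom x]; rewrite [RHS]big_map.
apply: eq_bigr => -[u v] _ /=; rewrite tensZl /tens -linearZ.
congr tensor_pi; apply/eqP/freeg_eqP => q.
by rewrite coeffZ !coeffU mul1r.
Qed.

Lemma tens_ind (Q : tensor -> Prop) :
  Q 0 -> (forall s t, Q s -> Q t -> Q (s + t)) -> (forall u v, Q (tens u v)) ->
  forall t, Q t.
Proof.
by move=> Q0 QD Qt t; have [s ->] := tens_spanP t; apply: big_ind.
Qed.

End TensorProduct.

Arguments tensor {k} (U V)%_type.

Notation "U ⊗ V" := (tensor U V) (at level 40, left associativity) : type_scope.
Notation "u ⊗ v" := (tens u v) (at level 40, left associativity) : ring_scope.

Section Lift.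
Context (k : fieldType) (U V W : lmodType k).
Implicit Type f : U -> V -> W.

(* The linear map induced by f, meaningful when f is bilinear. *)
Definition tlift f (t : U ⊗ V) : W :=
  fglift (fun p : U * V => f p.1 p.2) (repr (t : Quotient.quot (@tensor_rels k U V))).

Fact fglift_linear (K : choiceType) (g : K -> W) : linear (fglift (R := k) g).
Proof.
have addF x y : fglift g (x + y) = fglift g x + fglift g y :> W.
  have subF : zmod_morphism (fglift (R := k) g) by exact: lift_is_additive.
  have F0 : fglift g (0 : {freeg K / k}) = 0 by rewrite -[0 in LHS](subrr 0) subF subrr.
  by rewrite -[y in LHS]opprK subF -[- y]sub0r subF F0 sub0r opprK.
move=> a x y; rewrite addF; congr (_ + _).
have F0 : fglift g (0 : {freeg K / k}) = 0.
  by apply: (@addrI _ (fglift g 0)); rewrite -addF !addr0.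
have sumF (s : seq K) (h : K -> {freeg K / k}) :
    fglift g (\sum_(z <- s) h z) = \sum_(z <- s) fglift g (h z).
  by elim: s => [|z s IH]; rewrite ?big_nil // !big_cons addF IH.
rewrite -[x]freeg_sumE scaler_sumr !sumF scaler_sumr; apply: eq_bigr => z _.
rewrite liftU scalerA -(liftU g); congr fglift.
by apply/eqP/freeg_eqP => q; rewrite coeffZ !coeffU mulrA.
Qed.

Lemma tlift_pi f x : bilinear_for *:%R *:%R f ->
  tlift f (tensor_pi x) = fglift (fun p : U * V => f p.1 p.2) x.
Proof.
move=> [fl fr]; set F := fun p => _.
have [L LE] : exists L : {linear {freeg (U * V)%type / k} -> W},
    L =1 fglift (R := k) F.
  pose G := GRing.isLinear.Build _ _ _ *:%R _ (fglift_linear F).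
  pose L : {linear {freeg (U * V)%type / k} -> W} :=
    HB.pack (fglift (R := k) F) G.
  by exists L.
rewrite /tlift -/F -!LE; set y := repr _.
have: tensor_rel (x - y) by apply: tensor_pi_rel; rewrite tensor_piK.
suff relF z : tensor_rel z -> L z = 0.
  by move=> /relF /eqP; rewrite linearB subr_eq0 => /eqP ->.
have Lg p : L << p >> = F p by rewrite LE liftU scale1r.
have fDl u u' v : f (u + u') v = f u v + f u' v.
  by have := fl v 1 u u'; rewrite /= !scale1r.
have fDr u v v' : f u (v + v') = f u v + f u v'.
  by have := fr u 1 v v'; rewrite /= !scale1r.
have f0l v : f 0 v = 0 by apply: (@addrI _ (f 0 v)); rewrite -fDl !addr0.
have f0r u : f u 0 = 0 by apply: (@addrI _ (f u 0)); rewrite -fDr !addr0.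
have fZl a u v : f (a *: u) v = a *: f u v.
  by have := fl v a u 0; rewrite /= f0l !addr0.
have fZr a u v : f u (a *: v) = a *: f u v.
  by have := fr u a v 0; rewrite /= f0r !addr0.
elim=> {z} [|z z' _ z0 _ z0'|a z _ z0|u u' v|u v v'|a u v|a u v].
- exact: linear0.
- by rewrite linearD z0 z0' addr0.
- by rewrite linearZ /= z0 scaler0.
- by rewrite !linearB !Lg /F /= fDl -addrA -opprD subrr.
- by rewrite !linearB !Lg /F /= fDr -addrA -opprD subrr.
- by rewrite linearB linearZ /= !Lg /F /= fZl subrr.
- by rewrite linearB linearZ /= !Lg /F /= fZr subrr.
Qed.

Lemma tliftE f u v : bilinear_for *:%R *:%R f -> tlift f (u ⊗ v) = f u v.
Proof. by move=> bf; rewrite /tens tlift_pi // liftU scale1r. Qed.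

Lemma tlift_linear f : bilinear_for *:%R *:%R f -> linear (tlift f).
Proof.
move=> bf a s t; rewrite -[s]tensor_piK -[t]tensor_piK -linearP !tlift_pi //.
exact: fglift_linear.
Qed.

Lemma tlift0 f : bilinear_for *:%R *:%R f -> tlift f 0 = 0.
Proof.
move=> bf; have := tlift_linear bf (-1) 0 0.
by rewrite !scaleN1r oppr0 addr0 addNr.
Qed.

Lemma tliftD f s t : bilinear_for *:%R *:%R f ->
  tlift f (s + t) = tlift f s + tlift f t.
Proof. by move=> bf; have := tlift_linear bf 1 s t; rewrite !scale1r. Qed.

Lemma tliftZ f a t : bilinear_for *:%R *:%R f -> tlift f (a *: t) = a *: tlift f t.
Proof.
by move=> bf; have := tlift_linear bf a t 0; rewrite !addr0 tlift0 // addr0.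
Qed.

Lemma tlift_unique (f g : {linear (U ⊗ V)%type -> W}) :
  (forall u v, f (u ⊗ v) = g (u ⊗ v)) -> f =1 g.
Proof.
move=> fg; elim/tens_ind => [|s t es et|//]; first by rewrite !linear0.
by rewrite !linearD es et.
Qed.

End Lift.

Section TensorMap.
Context (k : fieldType) (U U' V V' : lmodType k).
Context (f : {linear U -> U'}) (g : {linear V -> V'}).

Definition tmap : U ⊗ V -> U' ⊗ V' := tlift (fun u v => f u ⊗ g v).

Fact tmap_bilinear :
  bilinear_for *:%R *:%R (fun u v => f u ⊗ g v : U' ⊗ V').
Proof.
by split=> [v a u u'|u a v v'] /=; rewrite linearP ?(tensDl, tensZl, tensDr, tensZr).
Qed.

Lemma tmapE u v : tmap (u ⊗ v) = f u ⊗ g v.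
Proof. exact/tliftE/tmap_bilinear. Qed.

HB.instance Definition _ := GRing.isLinear.Build k (U ⊗ V)%type (U' ⊗ V')%type *:%R
  tmap (tlift_linear tmap_bilinear).
End TensorMap.

Section Slice.
Context (k : fieldType) (U V : lmodType k).

(* The maps mu ⊗ id and id ⊗ mu, followed by the identifications of k ⊗ V
   with V and of U ⊗ k with U. *)
Definition slicel (mu : {scalar U}) : U ⊗ V -> V := tlift (fun u v => mu u *: v).
Definition slicer (mu : {scalar V}) : U ⊗ V -> U := tlift (fun u v => mu v *: u).

Fact slicel_bilinear (mu : {scalar U}) :
  bilinear_for *:%R *:%R (fun u (v : V) => mu u *: v).
Proof.
split=> [v a u u'|u a v v'] /=; first by rewrite linearP scalerDl scalerA.
by rewrite scalerDr !scalerA mulrC.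
Qed.

Fact slicer_bilinear (mu : {scalar V}) :
  bilinear_for *:%R *:%R (fun (u : U) v => mu v *: u).
Proof.
split=> [v a u u'|u a v v'] /=; last by rewrite linearP scalerDl scalerA.
by rewrite scalerDr !scalerA mulrC.
Qed.

Lemma slicelE mu u v : slicel mu (u ⊗ v) = mu u *: v.
Proof. exact/tliftE/slicel_bilinear. Qed.

Lemma slicerE mu u v : slicer mu (u ⊗ v) = mu v *: u.
Proof. exact/tliftE/slicer_bilinear. Qed.

HB.instance Definition _ mu := GRing.isLinear.Build k (U ⊗ V)%type V *:%R
  (slicel mu) (tlift_linear (slicel_bilinear mu)).
HB.instance Definition _ mu := GRing.isLinear.Build k (U ⊗ V)%type U *:%R
  (slicer mu) (tlift_linear (slicer_bilinear mu)).
End Slice.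

Section Associator.
Context (k : fieldType) (U V W : lmodType k).

Fact tassoc_bilinear1 (w : W) :
  bilinear_for *:%R *:%R (fun (u : U) (v : V) => u ⊗ (v ⊗ w)).
Proof.
split=> [v a u u'|u a v v'] /=; first by rewrite tensDl tensZl.
by rewrite tensDl tensZl tensDr tensZr.
Qed.

Definition tassoc : (U ⊗ V) ⊗ W -> U ⊗ (V ⊗ W) :=
  tlift (fun t w => tlift (fun u v => u ⊗ (v ⊗ w)) t).

Fact tassoc_bilinear : bilinear_for *:%R *:%R
  (fun (t : U ⊗ V) (w : W) => tlift (fun u v => u ⊗ (v ⊗ w)) t).
Proof.
split=> [w a s t|t a w w'] /=; first exact: tlift_linear (tassoc_bilinear1 w) _ _ _.
elim/tens_ind: t => [|s t es et|u v].
- by rewrite !tlift0 ?scaler0 ?addr0; try exact: tassoc_bilinear1.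
- rewrite !tliftD; try exact: tassoc_bilinear1.
  by rewrite es et scalerDr addrACA.
- rewrite !tliftE; try exact: tassoc_bilinear1.
  by rewrite tensDr tensZr tensDr tensZr.
Qed.

Lemma tassocE u v w : tassoc ((u ⊗ v) ⊗ w) = u ⊗ (v ⊗ w).
Proof.
rewrite /tassoc tliftE; last exact: tassoc_bilinear.
exact/tliftE/tassoc_bilinear1.
Qed.

HB.instance Definition _ := GRing.isLinear.Build k _ _ *:%R
  tassoc (tlift_linear tassoc_bilinear).
End Associator.

Section TensorAlgebra.
Context (k : fieldType) (A B : algType k).

Definition tensor_mul (s t : A ⊗ B) : A ⊗ B :=
  tlift (fun a b => tlift (fun c d => (a * c) ⊗ (b * d)) t) s.

Definition tensor_one : A ⊗ B := 1 ⊗ 1.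

Fact tensor_mul_bilinear1 (a : A) (b : B) :
  bilinear_for *:%R *:%R (fun c d => (a * c) ⊗ (b * d) : A ⊗ B).
Proof.
by split=> [d x c c'|c x d d'] /=;
  rewrite mulrDr -scalerAr ?(tensDl, tensZl, tensDr, tensZr).
Qed.

Fact tensor_mul_bilinear (t : A ⊗ B) : bilinear_for *:%R *:%R
  (fun a b => tlift (fun c d => (a * c) ⊗ (b * d) : A ⊗ B) t).
Proof.
have bf := tensor_mul_bilinear1.
split=> [b x a a'|a x b b'] /=; elim/tens_ind: t => [|s t es et|c d].
- by rewrite !(tlift0 (bf _ _)) scaler0 addr0.
- by rewrite !(tliftD _ _ (bf _ _)) es et scalerDr addrACA.
- by rewrite !(tliftE _ _ (bf _ _)) mulrDl -scalerAl tensDl tensZl.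
- by rewrite !(tlift0 (bf _ _)) scaler0 addr0.
- by rewrite !(tliftD _ _ (bf _ _)) es et scalerDr addrACA.
- by rewrite !(tliftE _ _ (bf _ _)) mulrDl -scalerAl tensDr tensZr.
Qed.

Fact tensor_mulE a b c d : tensor_mul (a ⊗ b) (c ⊗ d) = (a * c) ⊗ (b * d).
Proof.
rewrite /tensor_mul (tliftE _ _ (tensor_mul_bilinear _)).
exact/tliftE/tensor_mul_bilinear1.
Qed.

Fact tensor_mulDl : left_distributive tensor_mul +%R.
Proof. by move=> s s' t; apply/tliftD/tensor_mul_bilinear. Qed.

Fact tensor_mulDr : right_distributive tensor_mul +%R.
Proof.
have bf := tensor_mul_bilinear; move=> s t t'.
elim/tens_ind: s => [|r s er es|a b].
- by rewrite /tensor_mul !(tlift0 (bf _)) addr0.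
- by rewrite !tensor_mulDl er es addrACA.
- rewrite /tensor_mul !(tliftE _ _ (bf _)).
  exact/tliftD/tensor_mul_bilinear1.
Qed.

Fact tensor_mul0l t : tensor_mul 0 t = 0.
Proof. exact/tlift0/tensor_mul_bilinear. Qed.

Fact tensor_mul0r t : tensor_mul t 0 = 0.
Proof.
by apply: (@addrI _ (tensor_mul t 0)); rewrite -tensor_mulDr !addr0.
Qed.

Fact tensor_mulA : associative tensor_mul.
Proof.
move=> r s t; elim/tens_ind: r => [|r r' er er'|a b].
- by rewrite !tensor_mul0l.
- by rewrite !tensor_mulDl er er'.
elim/tens_ind: s => [|s s' es es'|c d].
- by rewrite !(tensor_mul0l, tensor_mul0r).
- by rewrite !(tensor_mulDl, tensor_mulDr) es es'.
elim/tens_ind: t => [|t t' et et'|e f].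
- by rewrite !tensor_mul0r.
- by rewrite !tensor_mulDr et et'.
- by rewrite !tensor_mulE !mulrA.
Qed.

Fact tensor_mul1l : left_id tensor_one tensor_mul.
Proof.
move=> t; elim/tens_ind: t => [|t t' et et'|a b].
- by rewrite tensor_mul0r.
- by rewrite tensor_mulDr et et'.
- by rewrite tensor_mulE !mul1r.
Qed.

Fact tensor_mul1r : right_id tensor_one tensor_mul.
Proof.
move=> t; elim/tens_ind: t => [|t t' et et'|a b].
- by rewrite tensor_mul0l.
- by rewrite tensor_mulDl et et'.
- by rewrite tensor_mulE !mulr1.
Qed.

HB.instance Definition _ := GRing.Zmodule_isPzRing.Build (A ⊗ B)%type
  tensor_mulA tensor_mul1l tensor_mul1r tensor_mulDl tensor_mulDr.

Lemma tensM (a c : A) (b d : B) : (a ⊗ b) * (c ⊗ d) = (a * c) ⊗ (b * d).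
Proof. exact: tensor_mulE. Qed.

Lemma tens1 : (1 : A) ⊗ (1 : B) = 1.
Proof. by []. Qed.

Fact tensor_scalerAl x (s t : A ⊗ B) : x *: (s * t) = (x *: s) * t.
Proof. exact/esym/tliftZ/tensor_mul_bilinear. Qed.

Fact tensor_scalerAr x (s t : A ⊗ B) : x *: (s * t) = s * (x *: t).
Proof.
elim/tens_ind: s => [|s s' es es'|a b].
- by rewrite !mul0r scaler0.
- by rewrite !mulrDl scalerDr es es'.
elim/tens_ind: t => [|t t' et et'|c d].
- by rewrite scaler0 !mulr0 scaler0.
- by rewrite scalerDr !mulrDr scalerDr et et'.
- by rewrite -tensZl !tensM -tensZl scalerAr.
Qed.

End TensorAlgebra.

Section Multiplication.
Context (k : fieldType) (A : algType k).

Definition tmulm : A ⊗ A -> A := tlift (fun a b => a * b).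

Fact tmulm_bilinear : bilinear_for *:%R *:%R (fun a b : A => a * b).
Proof.
by split=> [b x a a'|a x b b'] /=; rewrite (mulrDl, mulrDr) -(scalerAl, scalerAr).
Qed.

Lemma tmulmE a b : tmulm (a ⊗ b) = a * b.
Proof. exact/tliftE/tmulm_bilinear. Qed.

HB.instance Definition _ := GRing.isLinear.Build k (A ⊗ A)%type A *:%R
  tmulm (tlift_linear tmulm_bilinear).
End Multiplication.

HB.mixin Record Lmodule_isCoalgebra (k : fieldType) C of GRing.Lmodule k C := {
  comul : {linear C -> (C ⊗ C)%type};
  counit : {scalar C};
  comulA : forall x : C,
    tassoc (tmap comul idfun (comul x)) = tmap idfun comul (comul x);
  counitl : forall x : C, slicel counit (comul x) = x;
  counitr : forall x : C, slicer counit (comul x) = x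
}.

#[short(type="coalgType")]
HB.structure Definition Coalgebra (k : fieldType) :=
  {C of Lmodule_isCoalgebra k C & GRing.Lmodule k C}.

HB.mixin Record Algebra_Coalgebra_isBialgebra (k : fieldType) A
    of GRing.Algebra k A & Coalgebra k A := {
  comul1 : comul (1 : A) = 1 ⊗ 1;
  comulM : forall x y : A, comul (x * y) = (comul x * comul y : (A ⊗ A)%type);
  counit1 : counit (1 : A) = 1;
  counitM : forall x y : A, counit (x * y) = counit x * counit y
}.

#[short(type="bialgType")]
HB.structure Definition Bialgebra (k : fieldType) :=
  {A of Algebra_Coalgebra_isBialgebra k A & GRing.Algebra k A & Coalgebra k A}.

HB.mixin Record Bialgebra_isHopf (k : fieldType) A of Bialgebra k A := {
  antipode : {linear A -> A};
  antipodel : forall x : A,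
    tmulm (tmap antipode idfun (comul x)) = counit x *: 1;
  antipoder : forall x : A,
    tmulm (tmap idfun antipode (comul x)) = counit x *: 1
}.

#[short(type="hopfType")]
HB.structure Definition Hopf (k : fieldType) :=
  {A of Bialgebra_isHopf k A & Bialgebra k A}.

Section GroupLikeProjection.
Context (k : fieldType) (A : hopfType k).
Implicit Types P x : A.

Definition projection P := P * P = P.

Definition right_grouplike P :=
  [/\ P != 0, projection P,
      comul P * (1 ⊗ P) = P ⊗ P & (1 ⊗ P) * comul P = P ⊗ P].

Definition left_grouplike P :=
  [/\ P != 0, projection P,
      comul P * (P ⊗ 1) = P ⊗ P & (P ⊗ 1) * comul P = P ⊗ P].

Definition two_sided_grouplike P := right_grouplike P /\ left_grouplike P.

Definition NlP P : set A := [set x | (1 ⊗ P) * comul x = x ⊗ P].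
Definition NrP P : set A := [set x | comul x * (1 ⊗ P) = x ⊗ P].
Definition NP P : set A := NlP P `&` NrP P.

Definition VP P : set A :=
  [set x | exists mu : {scalar A}, x = slicel mu (comul P)].

(* X ⊗ Y as a subspace of A ⊗ A, for subspaces X and Y of A. *)
Definition tensor_set (X Y : set A) : set (A ⊗ A)%type :=
  [set t | exists s : seq (A * A),
     (forall p, p \in s -> X p.1 /\ Y p.2) /\ t = \sum_(p <- s) p.1 ⊗ p.2].

End GroupLikeProjection.

(* Main.v *)
From HB Require Import structures.
Require Import Defs.
From mathcomp Require Import all_boot all_algebra.
From mathcomp Require Import boolp classical_sets.

(** Write [S] for the antipode, [T] for its inverse, [x1 ⊗ x2] for [comul x].

    The group-like condition turns into multiplication by [S] and [T]. From
    [(S y1 ⊗ 1) (comul y2) = 1 ⊗ y] and [(comul y2) (T y1 ⊗ 1) = 1 ⊗ y] one gets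
    [(1 ⊗ y) (comul P) = (S y ⊗ 1) (comul P)] for [y] in [NrP P] and
    [(comul P) (1 ⊗ y) = (comul P) (T y ⊗ 1)] for [y] in [NlP P]
    ([NrP_shift], [NlP_shift]). With [y = P] these give
    [(S P ⊗ 1) (comul P) = P ⊗ P = (comul P) (T P ⊗ 1)], and [P * S P = S P]
    after applying the counit; if [P] is also left group-like then
    [P * S P = P]. So [P] is two sided exactly when [S P = P] ([two_sidedP]),
    and every condition is compared with [S P = P].

    Elements [n] of [NP P] satisfy [n * P = counit n *: P = P * n]. If [NP P]
    is stable under the square of [S], this applied to [S (S P)], and to the
    element that the square of [S] maps to [P], gives [S (S P) = P]; then
    [T P = S P] and [S P = P * T P = P]. If [comul P] lies in
    [S (NP P) ⊗ NP P], the same rule evaluates [(S P ⊗ 1) (comul P)] to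
    [S P ⊗ P], and this is also [P ⊗ P].

    Conversely let [S P = P]. By the shift identities [VP P] absorbs [NlP P] on
    the right and [NrP P] on the left, and [VP P] is contained in [NP P], so all
    the spaces agree as soon as [VP P] contains [1] ([VP1]). Since
    [comul P = comul (S P)] is the flip of [S ⊗ S] applied to [comul P], the
    left slices of [comul P] lie in [S (VP P)]; choosing an expression of
    [comul P] with the fewest terms places it in [S (VP P) ⊗ VP P]
    ([tens_slicesP], [comul_in_VP]). Hence [1 = P2 * T P1] is a sum of products
    of two elements of [VP P], and such products stay in [VP P]. *)

Set Implicit Arguments.
Unset Strict Implicit.
Unset Printing Implicit Defensive.

Import GRing.Theory.
Local Open Scope ring_scope.
Local Open Scope classical_set_scope.

(** * Multilinearity *)

Lemma mulrZl (k : fieldType) (A : algType k) (c : k) (x y : A) :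
  (c *: x) * y = c *: (x * y).
Proof. by rewrite scalerAl. Qed.

Lemma mulrZr (k : fieldType) (A : algType k) (c : k) (x y : A) :
  x * (c *: y) = c *: (x * y).
Proof. by rewrite scalerAr. Qed.

Lemma tens_mulZl (k : fieldType) (A B : algType k) (c : k) (s t : A ⊗ B) :
  (c *: s) * t = c *: (s * t).
Proof. by rewrite tensor_scalerAl. Qed.

Lemma tens_mulZr (k : fieldType) (A B : algType k) (c : k) (s t : A ⊗ B) :
  s * (c *: t) = c *: (s * t).
Proof. by rewrite tensor_scalerAr. Qed.

Ltac expand_linear :=
  repeat progress rewrite /= ?(linearD, mulrDl, mulrDr, tensDl, tensDr,
    mulrZl, mulrZr, tens_mulZl, tens_mulZr, tensZl, tensZr) ?linearZ /=.
Ltac solve_linear := by intros; move=> ? ? ?; expand_linear.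
Ltac solve_bilinear := by split=> ? ? ? ?; expand_linear.

(** * Linear forms and slices of a tensor *)

Section LinearForms.
Context (k : fieldType).

Definition scalar_of (U : lmodType k) (f : U -> k) (f_lin : scalar f) :
    {scalar U} :=
  HB.pack f (GRing.isLinear.Build _ _ _ _ _ f_lin).

(** By Zorn's lemma there is a subspace [N] containing [W] that is maximal among
    those avoiding [a]. Maximality forces [N] and [a] to span [U], and the form
    sought is the coefficient of [a] along [N]. *)
Lemma separating_form (U : lmodType k) (W : set U) (a : U) :
    W 0 -> (forall c x y, W x -> W y -> W (c *: x + y)) -> ~ W a ->
  exists mu : {scalar U}, mu a = 1 /\ forall x, W x -> mu x = 0.
Proof.
move=> W0 Wlin Wa.
(* The union with [W] makes the condition hold for the empty chain. *)
pose good (M : set U) := (forall c x y, (M `|` W) x -> (M `|` W) y ->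
  (M `|` W) (c *: x + y)) /\ ~ (M `|` W) a.
have [|M [[Nlin Na] Nmax]] := @Zorn_bigcup U good.
  move=> F Fgood Ftot; split; last first.
    by move=> [[X FX Xa]|//]; case: (Fgood X FX) => _; apply; left.
  have step X c x y : F X -> (X `|` W) x -> (X `|` W) y ->
      ((\bigcup_(Z in F) Z) `|` W) (c *: x + y).
    move=> FX Xx Xy; have [Xlin _] := Fgood X FX.
    by case: (Xlin c x y Xx Xy) => ?; [left; exists X|right].
  move=> c x y [[X FX Xx]|Wx] [[Y FY Yy]|Wy].
  - have [XY|YX] := Ftot X Y FX FY.
      by apply: (step Y) => //; left => //; apply: XY.
    by apply: (step X) => //; left => //; apply: YX.
  - by apply: (step X) => //; [left|right].
  - by apply: (step Y) => //; [right|left].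
  - by right; apply: Wlin.
set N := M `|` W in Nlin Na.
have N0 : N 0 by right.
have NZ c x : N x -> N (c *: x) by move=> Nx; rewrite -[_ *: x]addr0; apply: Nlin.
have coefE x : exists c, N (x - c *: a).
  have [Nx|Nx] := pselect (N x); first by exists 0; rewrite scale0r subr0.
  have [[c [n [Nn ca]]]|no] := pselect (exists c n, N n /\ a = c *: x + n).
    have c0 : c != 0.
      by apply/eqP => c0; apply: Na; rewrite ca c0 scale0r add0r.
    exists c^-1; rewrite ca scalerDr scalerA mulVf // scale1r opprD addrA subrr.
    by rewrite add0r -scaleNr; apply: NZ.
  pose N' := [set y | exists c n, N n /\ y = c *: x + n].
  have NN' y : N y -> N' y by exists 0, y; rewrite scale0r add0r.
  have N'E : N' `|` W = N'.
    by apply/seteqP; split=> [y [//|Wy]|y]; [apply: NN'; right|left].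
  case: (Nmax N').
    split=> [y My|N'M]; first by apply: NN'; left.
    by apply: Nx; left; apply: N'M; exists 1, 0; rewrite scale1r addr0.
  rewrite /good N'E; split=> [c y z [d [n [Nn ->]]] [e [m [Nm ->]]]|//].
  exists (c * d + e), (c *: n + m); split; first exact: Nlin.
  by rewrite scalerDr scalerDl scalerA addrACA.
pose f x := sval (cid (coefE x)).
have fP x : N (x - f x *: a) by rewrite /f; case: (cid _).
have f_uniq x c : N (x - c *: a) -> f x = c.
  move=> Nc; apply/eqP; apply: contra_notT Na => fc.
  have -> : a = (f x - c)^-1 *: (-1 *: (x - f x *: a) + (x - c *: a)).
    rewrite scaleN1r opprB addrA subrK -scalerBl scalerA mulVf ?scale1r //.
    by rewrite subr_eq0.
  by apply: NZ; apply: Nlin.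
have f_lin : scalar f.
  move=> c x y; apply: f_uniq.
  have -> : c *: x + y - (c * f x + f y) *: a
      = c *: (x - f x *: a) + (y - f y *: a).
    by rewrite scalerBr scalerDl scalerA opprD addrACA.
  exact: Nlin.
exists (scalar_of f_lin); split=> [|x Wx] /=; apply: f_uniq.
  by rewrite scale1r subrr.
by rewrite scale0r subr0; right.
Qed.

Lemma tens_suml (U V : lmodType k) I (s : seq I) (Q : pred I) (f : I -> U) (v : V) :
  (\sum_(i <- s | Q i) f i) ⊗ v = \sum_(i <- s | Q i) f i ⊗ v.
Proof.
apply: (big_morph (fun u => u ⊗ v)) => [u u'|]; first exact: tensDl.
by rewrite -(scale0r 0) tensZl scale0r.
Qed.

Lemma tens_sumr (U V : lmodType k) I (s : seq I) (Q : pred I) (u : U) (f : I -> V) :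
  u ⊗ (\sum_(i <- s | Q i) f i) = \sum_(i <- s | Q i) u ⊗ f i.
Proof.
apply: (big_morph (tens u)) => [v v'|]; first exact: tensDr.
by rewrite -(scale0r 0) tensZr scale0r.
Qed.

Definition tens_sum (U V : lmodType k) (s : seq (U * V)) : U ⊗ V :=
  \sum_(p <- s) p.1 ⊗ p.2.

Definition shortest (U V : lmodType k) (s : seq (U * V)) :=
  forall s', tens_sum s' = tens_sum s -> (size s <= size s')%N.

(** In an expression with the fewest terms the left factors are linearly
    independent, as a dependent one could be absorbed into the other terms; a
    form that is 1 on one of them and 0 on the others then slices out its
    partner. *)
Lemma shortest_slicel (U V : lmodType k) (s : seq (U * V)) p :
  shortest s -> p \in s -> exists mu : {scalar U}, p.2 = slicel mu (tens_sum s).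
Proof.
move=> s_min /(nthP 0) [m ms <-].
pose i := Ordinal ms; pose a (j : 'I_(size s)) := (nth 0 s j).1.
pose b (j : 'I_(size s)) := (nth 0 s j).2.
have sE : tens_sum s = a i ⊗ b i + \sum_(j | j != i) a j ⊗ b j.
  by rewrite /tens_sum (big_nth 0) big_mkord (bigD1 i).
pose W := [set x | exists c : 'I_(size s) -> k, x = \sum_(j | j != i) c j *: a j].
have [|c x y [d ->] [e ->]|[c ai]|mu [mu1 mu0]] := @separating_form U W (a i).
- by exists (fun=> 0); rewrite big1 // => j _; rewrite scale0r.
- exists (fun j => c * d j + e j); rewrite scaler_sumr -big_split /=.
  by apply: eq_bigr => j _; rewrite scalerDl scalerA.
- pose s' := [seq (a j, b j + c j *: b i) | j <- enum (predC1 i)].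
  have /s_min : tens_sum s' = tens_sum s.
    rewrite sE ai /tens_sum big_map big_enum /= tens_suml -big_split /=.
    by apply: eq_bigr => j _; rewrite tensDr tensZl tensZr addrC.
  rewrite size_map -cardE cardC1 card_ord leqNgt prednK ?leqnn //.
  by rewrite (leq_ltn_trans _ ms).
exists mu; rewrite sE linearD linear_sum /= slicelE mu1 scale1r.
rewrite big1 ?addr0 // => j ji; rewrite slicelE mu0 ?scale0r //.
exists (fun j' => (j' == j)%:R); rewrite (bigD1 j) //= eqxx scale1r.
by rewrite big1 ?addr0 // => l /andP [_ /negPf ->]; rewrite scale0r.
Qed.

Lemma tlift_big (U V W : lmodType k) (F : U -> V -> W) I (s : seq I)
    (h : I -> U ⊗ V) :
  bilinear_for *:%R *:%R F ->
  tlift F (\sum_(i <- s) h i) = \sum_(i <- s) tlift F (h i).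
Proof.
move=> Fbil; elim: s => [|i s IH]; first by rewrite !big_nil tlift0.
by rewrite !big_cons tliftD // IH.
Qed.

Lemma tlift_sum (U V W : lmodType k) (F : U -> V -> W) I (s : seq I) f g :
  bilinear_for *:%R *:%R F ->
  tlift F (\sum_(i <- s) f i ⊗ g i) = \sum_(i <- s) F (f i) (g i).
Proof.
by move=> Fbil; rewrite tlift_big //; apply: eq_bigr => i _; rewrite tliftE.
Qed.

(** A tensor lies in the tensor product of its spaces of left and right slices:
    [shortest_slicel] applies both to a shortest expression and to its flip. *)
Lemma tens_slicesP (U V : lmodType k) (t : U ⊗ V) :
  exists s : seq (U * V), t = tens_sum s /\ forall p, p \in s ->
    (exists nu : {scalar V}, p.1 = slicer nu t) /\
    (exists mu : {scalar U}, p.2 = slicel mu t).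
Proof.
pose len n := `[< exists2 s, t = tens_sum s & size s = n >].
have [|n /asboolP [s ts sn] n_min] := @ex_minnP len.
  by have [s ts] := tens_spanP t; exists (size s); apply/asboolP; exists s.
have s_min : shortest s.
  move=> s' ss'; rewrite sn; apply: n_min; apply/asboolP.
  by exists s' => //; rewrite ts.
pose swap U' V' (q : U' * V') := (q.2, q.1).
have flip (U' V' : lmodType k) (r : seq (U' * V')) :
    tlift (fun u v => v ⊗ u) (tens_sum r) = tens_sum (map (@swap U' V') r).
  by rewrite /tens_sum big_map tlift_sum //; solve_bilinear.
have s'_min : shortest (map (@swap U V) s).
  move=> r rs; rewrite size_map -(size_map (@swap V U) r); apply: s_min.
  by rewrite -flip rs flip -map_comp map_id_in // => -[].
exists s; split=> // p ps; split; last by rewrite ts; apply: shortest_slicel.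
have [|nu] := shortest_slicel s'_min (p := swap _ _ p).
  exact: map_f.
rewrite ts /= /tens_sum linear_sum big_map /= => ->; exists nu.
rewrite linear_sum /=.
by apply: eq_bigr => q _; rewrite slicelE slicerE.
Qed.
End LinearForms.

(** * Sweedler notation *)

Section Sweedler.
Context (k : fieldType).

(** A choice of terms [x1 ⊗ x2] adding up to [comul x]. Sums over them
    depend on the choice unless the summand is bilinear, whence the hypotheses
    of the lemmas below. *)
Definition sweedler (C : coalgType k) (x : C) : seq (C * C) :=
  projT1 (cid (tens_spanP (comul x))).

Lemma comulE (C : coalgType k) (x : C) :
  comul x = \sum_(p <- sweedler x) p.1 ⊗ p.2.
Proof. by rewrite /sweedler; case: (cid _). Qed.

Lemma sweedler_eq (C : coalgType k) (W : lmodType k) (F : C -> C -> W) (x : C)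
    I (s : seq I) f g :
  bilinear_for *:%R *:%R F -> comul x = \sum_(i <- s) f i ⊗ g i ->
  \sum_(p <- sweedler x) F p.1 p.2 = \sum_(i <- s) F (f i) (g i).
Proof. by move=> Fbil xE; rewrite -!(tlift_sum _ _ _ Fbil) -xE -comulE. Qed.

Lemma sweedler_coassoc (C : coalgType k) (W : lmodType k) (F : C -> C -> C -> W)
    (x : C) :
  (forall b c, linear (fun a => F a b c)) ->
  (forall a c, linear (fun b => F a b c)) ->
  (forall a b, linear (F a b)) ->
  \sum_(p <- sweedler x) \sum_(q <- sweedler p.1) F q.1 q.2 p.2 =
  \sum_(p <- sweedler x) \sum_(q <- sweedler p.2) F p.1 q.1 q.2.
Proof.
move=> lin1 lin2 lin3.
have bil a : bilinear_for *:%R *:%R (F a) by split=> [c|b]; [apply: lin2|apply: lin3].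
pose G a t := tlift (F a) t.
have Gbil : bilinear_for *:%R *:%R G.
  split=> [t c a a'|a c t t'] /=; last exact: tlift_linear.
  elim/tens_ind: t => [|t t' et et'|u v].
  - by rewrite /G !tlift0 // scaler0 addr0.
  - have GD u : G u (t + t') = G u t + G u t' by rewrite /G tliftD.
    by rewrite !GD et et' scalerDr addrACA.
  - by rewrite /G !tliftE //; apply: lin1.
transitivity (tlift G (tassoc (tmap comul idfun (comul x)))).
  rewrite comulE !linear_sum (tlift_big _ _ Gbil); apply: eq_bigr => p _ /=.
  rewrite tmapE comulE tens_suml linear_sum (tlift_big _ _ Gbil) /=.
  by apply: eq_bigr => q _; rewrite tassocE tliftE // /G tliftE.
rewrite comulA comulE linear_sum (tlift_big _ _ Gbil); apply: eq_bigr => p _ /=.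
by rewrite tmapE tliftE // comulE /G tlift_sum.
Qed.

Lemma sweedler_counitl (C : coalgType k) (x : C) :
  \sum_(p <- sweedler x) counit p.1 *: p.2 = x.
Proof.
rewrite -[RHS]counitl comulE linear_sum /=.
by apply: eq_bigr => p _; rewrite slicelE.
Qed.

Lemma sweedler_counitr (C : coalgType k) (x : C) :
  \sum_(p <- sweedler x) counit p.2 *: p.1 = x.
Proof.
rewrite -[RHS]counitr comulE linear_sum /=.
by apply: eq_bigr => p _; rewrite slicerE.
Qed.

(** * The antipode reverses products *)

Section Antipode.
Context (A : hopfType k).
Local Notation S := (antipode : A -> A).

Lemma sweedlerM (W : lmodType k) (F : A -> A -> W) (x y : A) :
  bilinear_for *:%R *:%R F ->
  \sum_(p <- sweedler (x * y)) F p.1 p.2 =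
  \sum_(p <- sweedler x) \sum_(q <- sweedler y) F (p.1 * q.1) (p.2 * q.2).
Proof.
move=> Fbil.
rewrite (sweedler_eq (s := [seq (p.1 * q.1, p.2 * q.2)
    | p <- sweedler x, q <- sweedler y]) (f := fst) (g := snd)) //; last first.
  rewrite comulM !comulE mulr_suml big_allpairs_dep /=; apply: eq_bigr => p _.
  by rewrite mulr_sumr; apply: eq_bigr => q _; rewrite tensM.
by rewrite !big_allpairs_dep.
Qed.

Lemma sweedler_antipodel (x : A) :
  \sum_(p <- sweedler x) S p.1 * p.2 = counit x *: 1.
Proof.
rewrite -antipodel comulE !linear_sum /=.
by apply: eq_bigr => p _; rewrite tmapE tmulmE.
Qed.

Lemma sweedler_antipoder (x : A) :
  \sum_(p <- sweedler x) p.1 * S p.2 = counit x *: 1.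
Proof.
rewrite -antipoder comulE !linear_sum /=.
by apply: eq_bigr => p _; rewrite tmapE tmulmE.
Qed.

(** Both sides are [S (x1 * y1) * x2 * y2 * S y3]. *)
Lemma sweedler_antipodel_mul (x y : A) :
  \sum_(p <- sweedler x) S (p.1 * y) * p.2 = counit x *: S y.
Proof.
rewrite -{2}(sweedler_counitl y) linear_sum scaler_sumr.
under [RHS]eq_bigr => q _.
  rewrite linearZ /= scalerA -counitM -[S q.2]mul1r scalerAl -sweedler_antipodel.
  rewrite (sweedlerM (F := fun a b => S a * b)); last by solve_bilinear.
  rewrite mulr_suml; under eq_bigr => p _ do rewrite mulr_suml.
over.
rewrite exchange_big /=; apply: eq_bigr => p _; symmetry.
rewrite (sweedler_coassoc (F := fun a b c => S (p.1 * a) * (p.2 * b) * S c));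
  try by solve_linear.
under eq_bigr => q _.
  under eq_bigr => r _ do rewrite -!mulrA.
  rewrite -mulr_sumr -mulr_sumr sweedler_antipoder -!scalerAr mulr1.
  rewrite scalerAl -linearZ scalerAr /=.
over.
by rewrite -mulr_suml -linear_sum -mulr_sumr /= sweedler_counitr.
Qed.

(** [S (x1 * y) * x2 * S x3] can be evaluated from either end. *)
Lemma antipodeM (x y : A) : S (x * y) = S y * S x.
Proof.
rewrite -{1}(sweedler_counitr x) mulr_suml linear_sum /=.
under eq_bigr => p _.
  rewrite -scalerAl linearZ /= -[S _]mulr1 scalerAr -sweedler_antipoder mulr_sumr.
over.
rewrite -(sweedler_coassoc (F := fun a b c => S (a * y) * (b * S c)));
  try by solve_linear.
under eq_bigr => p _.
  under eq_bigr => q _ do rewrite mulrA.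
  rewrite -mulr_suml sweedler_antipodel_mul -scalerAl scalerAr -linearZ /=.
over.
by rewrite -mulr_sumr -linear_sum sweedler_counitl.
Qed.

Lemma antipode1 : S 1 = 1.
Proof.
have := antipodel (1 : A).
by rewrite comul1 tmapE tmulmE mulr1 counit1 scale1r.
Qed.

Lemma counit_antipode (x : A) : counit (S x) = counit x.
Proof.
have := congr1 counit (sweedler_antipodel x).
rewrite linearZ /= counit1 mulr1 => <-.
rewrite -{1}(sweedler_counitr x) !linear_sum /=.
by apply: eq_bigr => p _; rewrite !linearZ /= counitM mulrC.
Qed.

(** * Galois identities; the antipode reverses coproducts *)

Lemma galois_left (y : A) :
  \sum_(p <- sweedler y) (S p.1 ⊗ 1) * comul p.2 = 1 ⊗ y.
Proof.
under eq_bigr => p _.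
  rewrite comulE mulr_sumr; under eq_bigr => q _ do rewrite tensM mul1r.
over.
rewrite -(sweedler_coassoc (F := fun a b c => (S a * b) ⊗ c));
  try by solve_linear.
under eq_bigr => p _.
  rewrite -tens_suml sweedler_antipodel tensZl -tensZr.
over.
by rewrite -tens_sumr sweedler_counitl.
Qed.

Lemma galois_right (y : A) :
  \sum_(p <- sweedler y) comul p.1 * (1 ⊗ S p.2) = y ⊗ 1.
Proof.
under eq_bigr => p _.
  rewrite comulE mulr_suml; under eq_bigr => q _ do rewrite tensM mulr1.
over.
rewrite (sweedler_coassoc (F := fun a b c => a ⊗ (b * S c)));
  try by solve_linear.
under eq_bigr => p _.
  rewrite -tens_sumr sweedler_antipoder tensZr -tensZl.
over.
by rewrite -tens_suml sweedler_counitr.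
Qed.

(** Both sides are [comul (S x1) * comul x2 * (1 ⊗ S x3)]. *)
Lemma sweedler_comul_antipode_mul (x : A) :
  \sum_(p <- sweedler x) comul (S p.1) * (p.2 ⊗ 1) = 1 ⊗ S x.
Proof.
under eq_bigr => p _ do rewrite -galois_right mulr_sumr.
rewrite -(sweedler_coassoc
  (F := fun a b c => comul (S a) * (comul b * (1 ⊗ S c)))); try by solve_linear.
under eq_bigr => p _.
  under eq_bigr => q _ do rewrite mulrA -comulM.
  rewrite -mulr_suml -linear_sum sweedler_antipodel linearZ /= comul1 tens1.
  rewrite tens_mulZl mul1r -tensZr -linearZ /=.
over.
by rewrite -tens_sumr -linear_sum sweedler_counitl.
Qed.

(** [comul (S x1) * (x2 ⊗ 1) * (S x3 ⊗ 1)] can be evaluated from either end. *)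
Lemma comul_antipode (x : A) :
  comul (S x) = \sum_(p <- sweedler x) S p.2 ⊗ S p.1.
Proof.
rewrite -{1}(sweedler_counitr x) !linear_sum /=.
under eq_bigr => p _.
  rewrite !linearZ /= -[comul _]mulr1 -tens_mulZr -tens1 -tensZl.
  rewrite -sweedler_antipoder tens_suml mulr_sumr.
over.
rewrite -(sweedler_coassoc
  (F := fun a b c => comul (S a) * ((b * S c) ⊗ 1))); try by solve_linear.
apply: eq_bigr => p _.
under eq_bigr => q _ do rewrite -[1](mulr1 1) -tensM mulrA.
by rewrite -mulr_suml sweedler_comul_antipode_mul tensM mul1r mulr1.
Qed.

Section Inverse.
Context (T : {linear A -> A}) (SK : cancel S T) (TK : cancel T S).

Lemma sweedler_antipode_inverse (x : A) :
  \sum_(p <- sweedler x) p.2 * T p.1 = counit x *: 1.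
Proof.
rewrite -[LHS]SK linear_sum /=.
under eq_bigr => p _ do rewrite antipodeM TK.
by rewrite sweedler_antipoder -[1 in LHS]antipode1 -linearZ SK.
Qed.

Lemma galois_inverse (y : A) :
  \sum_(p <- sweedler y) comul p.2 * (T p.1 ⊗ 1) = 1 ⊗ y.
Proof.
under eq_bigr => p _.
  rewrite comulE mulr_suml; under eq_bigr => q _ do rewrite tensM mulr1.
over.
rewrite -(sweedler_coassoc (F := fun a b c => (b * T a) ⊗ c));
  try by solve_linear.
under eq_bigr => p _.
  rewrite -tens_suml sweedler_antipode_inverse tensZl -tensZr.
over.
by rewrite -tens_sumr sweedler_counitl.
Qed.

(** * Group-like projections *)

(** Apply the map [a ⊗ b |-> (S a ⊗ 1) * comul b] to the identity
    [comul y * (1 ⊗ P) = y ⊗ P] that defines [NrP P]: the left side collapses by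
    [galois_left]. *)
Lemma NrP_shift (P y : A) :
  NrP P y -> (1 ⊗ y) * comul P = (S y ⊗ 1) * comul P.
Proof.
move=> Ny; have Fbil : bilinear_for *:%R *:%R
    (fun a b : A => (S a ⊗ 1 : (A ⊗ A)%type) * comul b) by solve_bilinear.
rewrite -[RHS](tliftE _ _ Fbil) -Ny (comulE y) mulr_suml.
under eq_bigr => p _ do rewrite tensM mulr1.
rewrite tlift_sum //; under eq_bigr => p _ do rewrite comulM mulrA.
by rewrite -mulr_suml galois_left.
Qed.

(** The mirror image of [NrP_shift], with [a ⊗ b |-> comul b * (T a ⊗ 1)]. *)
Lemma NlP_shift (P y : A) :
  NlP P y -> comul P * (1 ⊗ y) = comul P * (T y ⊗ 1).
Proof.
move=> Ny; have Fbil : bilinear_for *:%R *:%R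
    (fun a b : A => comul b * (T a ⊗ 1 : (A ⊗ A)%type)) by solve_bilinear.
rewrite -[RHS](tliftE _ _ Fbil) -Ny (comulE y) mulr_sumr.
under eq_bigr => p _ do rewrite tensM mul1r.
rewrite tlift_sum //; under eq_bigr => p _ do rewrite comulM -mulrA.
by rewrite -mulr_sumr galois_inverse.
Qed.
End Inverse.

Lemma slicel_counitM (s t : (A ⊗ A)%type) :
  slicel counit (s * t) = slicel counit s * slicel counit t.
Proof.
elim/tens_ind: s => [|s s' es es'|a b]; first by rewrite mul0r linear0 mul0r.
  by rewrite mulrDl !linearD /= es es' mulrDl.
elim/tens_ind: t => [|t t' et et'|c d]; first by rewrite mulr0 linear0 mulr0.
  by rewrite mulrDr !linearD /= et et' mulrDr.
by rewrite tensM !slicelE counitM mulrZl mulrZr scalerA.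
Qed.

Lemma slicer_counitM (s t : (A ⊗ A)%type) :
  slicer counit (s * t) = slicer counit s * slicer counit t.
Proof.
elim/tens_ind: s => [|s s' es es'|a b]; first by rewrite mul0r linear0 mul0r.
  by rewrite mulrDl !linearD /= es es' mulrDl.
elim/tens_ind: t => [|t t' et et'|c d]; first by rewrite mulr0 linear0 mulr0.
  by rewrite mulrDr !linearD /= et et' mulrDr.
by rewrite tensM !slicerE counitM mulrZl mulrZr scalerA.
Qed.

Lemma NlP_counit (P x : A) : NlP P x -> P * x = counit x *: P.
Proof.
move=> /(congr1 (slicel counit)).
by rewrite slicel_counitM !slicelE counitl counit1 scale1r.
Qed.

Lemma NrP_counit (P x : A) : NrP P x -> x * P = counit x *: P.
Proof.
move=> /(congr1 (slicel counit)).
by rewrite slicel_counitM !slicelE counitl counit1 scale1r.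
Qed.

Lemma comul_slicel (mu : {scalar A}) (x : A) :
  comul (slicel mu (comul x)) =
  \sum_(p <- sweedler x) slicel mu (comul p.1) ⊗ p.2.
Proof.
rewrite (comulE x) !linear_sum /=.
under eq_bigr => p _ do rewrite slicelE linearZ /= comulE scaler_sumr.
rewrite -(sweedler_coassoc (F := fun a b c => mu a *: (b ⊗ c))); first last.
- by move=> a b c u u'; rewrite tensDr tensZr scalerDr !scalerA mulrC.
- by move=> a b c u u'; rewrite tensDl tensZl scalerDr !scalerA mulrC.
- by move=> b c a u u'; rewrite linearP scalerDl scalerA.
apply: eq_bigr => p _; rewrite [in RHS]comulE linear_sum tens_suml.
by apply: eq_bigr => q _; rewrite /= slicelE tensZl.
Qed.

(** [NlP P] and [NrP P] are left coideals: slicing the first leg commutes with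
    multiplying the last one by [P]. *)
Lemma NlP_slicel (P x : A) (mu : {scalar A}) :
  NlP P x -> NlP P (slicel mu (comul x)).
Proof.
move=> Nx; have Fbil : bilinear_for *:%R *:%R
    (fun a b => slicel mu (comul a) ⊗ b : (A ⊗ A)%type) by solve_bilinear.
rewrite /NlP /= -(tliftE x P Fbil) -[x ⊗ P]Nx comul_slicel (comulE x) !mulr_sumr.
under [in RHS]eq_bigr => p _ do rewrite tensM mul1r.
by rewrite tlift_sum //; apply: eq_bigr => p _; rewrite tensM mul1r.
Qed.

Lemma NrP_slicel (P x : A) (mu : {scalar A}) :
  NrP P x -> NrP P (slicel mu (comul x)).
Proof.
move=> Nx; have Fbil : bilinear_for *:%R *:%R
    (fun a b => slicel mu (comul a) ⊗ b : (A ⊗ A)%type) by solve_bilinear.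
rewrite /NrP /= -(tliftE x P Fbil) -[x ⊗ P]Nx comul_slicel (comulE x) !mulr_suml.
under [in RHS]eq_bigr => p _ do rewrite tensM mulr1.
by rewrite tlift_sum //; apply: eq_bigr => p _; rewrite tensM mulr1.
Qed.

Section RightGrouplike.
Context (T : {linear A -> A}) (SK : cancel S T) (TK : cancel T S).
Context (P : A) (P_right : right_grouplike P).

Lemma NlP_self : NlP P P. Proof. by case: P_right. Qed.
Lemma NrP_self : NrP P P. Proof. by case: P_right. Qed.
Lemma NP_self : NP P P. Proof. by split; [apply: NlP_self|apply: NrP_self]. Qed.

Lemma counit_grouplike : counit P = 1.
Proof.
case: P_right => P0 PP _ _; apply/eqP; rewrite -subr_eq0.
have := NlP_counit NlP_self; rewrite PP -{1}[P]scale1r => /eqP.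
by rewrite -subr_eq0 -scalerBl scaler_eq0 (negPf P0) orbF -oppr_eq0 opprB.
Qed.

Lemma antipode_mul_grouplike : (S P ⊗ 1) * comul P = P ⊗ P.
Proof. by rewrite -(NrP_shift NrP_self) NlP_self. Qed.

Lemma grouplike_mul_antipode_inverse : comul P * (T P ⊗ 1) = P ⊗ P.
Proof. by rewrite -(NlP_shift SK TK NlP_self) NrP_self. Qed.

Lemma grouplike_mul_antipode : P * S P = S P.
Proof.
have := congr1 (slicer counit) grouplike_mul_antipode_inverse.
rewrite slicer_counitM !slicerE counitr counit1 counit_grouplike !scale1r.
by move=> /(congr1 S); rewrite antipodeM TK.
Qed.

(** Apply the map [a ⊗ b |-> comul a * (1 ⊗ S b)] to
    [(P ⊗ 1) * comul P = P ⊗ P], collapse by [galois_right], and take counits. *)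
Lemma left_grouplike_mul_antipode : left_grouplike P -> P * S P = P.
Proof.
case=> _ _ PlP PPl; have Fbil : bilinear_for *:%R *:%R
    (fun a b : A => comul a * (1 ⊗ S b : (A ⊗ A)%type)) by solve_bilinear.
have E : comul P * (1 ⊗ S P) = P ⊗ P.
  rewrite -[LHS](tliftE _ _ Fbil) -PPl {1}comulE mulr_sumr.
  under eq_bigr => p _ do rewrite tensM mul1r.
  rewrite tlift_sum //; under eq_bigr => p _ do rewrite comulM -mulrA.
  by rewrite -mulr_sumr galois_right PlP PPl.
have := congr1 (slicel counit) E.
by rewrite slicel_counitM !slicelE counitl counit1 counit_grouplike !scale1r.
Qed.

(** A right group-like [P] satisfies [P * S P = S P] and a left one
    [P * S P = P], so a two sided one is fixed by [S]. If it is fixed by [S],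
    and thus by [T], [antipode_mul_grouplike] and
    [grouplike_mul_antipode_inverse] are the left group-like conditions. *)
Lemma two_sidedP : two_sided_grouplike P <-> S P = P.
Proof.
split=> [[_ Pl]|SP].
  by rewrite -grouplike_mul_antipode left_grouplike_mul_antipode.
have TP : T P = P by rewrite -{1}SP SK.
split=> //; case: P_right => P0 PP _ _; split=> //.
  by rewrite -{2}TP grouplike_mul_antipode_inverse.
by rewrite -{1}SP antipode_mul_grouplike.
Qed.

(** Stability puts [S (S P)] and a preimage [n] of [P] in [NP P], so both act on
    [P] by their counit, which is 1. *)
Lemma two_sided_of_stable :
  (fun x : A => S (S x)) @` NP P = NP P -> S P = P.
Proof.
move=> SSN.
have SSP : S (S P) = P.
  have PSS : P * S (S P) = P.
    have [Nl _] : NP P (S (S P)) by rewrite -SSN; exists P => //; apply: NP_self.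
    by rewrite (NlP_counit Nl) !counit_antipode counit_grouplike scale1r.
  have [n [_ Nn] SSn] : ((fun x : A => S (S x)) @` NP P) P.
    by rewrite SSN; apply: NP_self.
  have := NrP_counit Nn.
  rewrite -(counit_antipode n) -(counit_antipode (S n)) SSn counit_grouplike.
  by rewrite scale1r => /(congr1 (fun x => S (S x))); rewrite !antipodeM SSn PSS.
have TP : T P = S P by rewrite -{1}SSP SK.
rewrite -grouplike_mul_antipode -TP.
have := congr1 (slicer counit) grouplike_mul_antipode_inverse.
by rewrite slicer_counitM !slicerE counitr counit1 counit_grouplike !scale1r.
Qed.

(** For [n] in [NP P], [S P * S n = S (n * P)] is a multiple of [S P] by
    [counit n], so the left leg of [(S P ⊗ 1) * comul P] is all absorbed. *)
Lemma two_sided_of_comul :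
  tensor_set ((fun x : A => S x) @` NP P) (NP P) (comul P) -> S P = P.
Proof.
case=> s [sN PE].
have E : S P ⊗ P = P ⊗ P.
  rewrite -antipode_mul_grouplike -{2}[P]counitl PE mulr_sumr linear_sum tens_sumr.
  rewrite [LHS]big_seq [RHS]big_seq; apply: eq_bigr => p ps.
  have [[n [_ Nn] <-] _] := sN p ps.
  rewrite /= slicelE tensM mul1r -antipodeM (NrP_counit Nn) linearZ counit_antipode.
  by rewrite tensZr tensZl.
have := congr1 (slicer counit) E.
by rewrite !slicerE counit_grouplike !scale1r.
Qed.

Lemma VP_sub_NP : VP P `<=` NP P.
Proof.
move=> x [mu ->]; split; first exact: NlP_slicel NlP_self.
exact: NrP_slicel NrP_self.
Qed.

Lemma VP_intro (f : A -> k) (x : A) : scalar f ->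
  x = \sum_(p <- sweedler P) f p.1 *: p.2 -> VP P x.
Proof.
move=> f_lin ->; exists (scalar_of f_lin); rewrite comulE linear_sum /=.
by apply: eq_bigr => p _; rewrite slicelE.
Qed.

Lemma VP0 : VP P 0.
Proof.
apply: (VP_intro (f := fun=> 0)) => [c a b|]; first by rewrite mulr0 addr0.
by rewrite big1 // => p _; rewrite scale0r.
Qed.

Lemma VPD (x y : A) : VP P x -> VP P y -> VP P (x + y).
Proof.
move=> [mu ->] [nu ->]; apply: (VP_intro (f := fun a => mu a + nu a)).
  by move=> c a b; rewrite !linearP mulrDr addrACA.
rewrite comulE !linear_sum -big_split /=.
by apply: eq_bigr => p _; rewrite !slicelE scalerDl.
Qed.

(** [NlP_shift] moves the factor [x] to the first leg of [comul P], where it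
    only changes the form used for slicing. *)
Lemma VP_mul_NlP (v x : A) : VP P v -> NlP P x -> VP P (v * x).
Proof.
move=> [mu ->] Nx; apply: (VP_intro (f := fun a => mu (a * T x))).
  by move=> c a b; rewrite mulrDl mulrZl linearP.
have := congr1 (slicel mu) (NlP_shift SK TK Nx).
rewrite !comulE !mulr_suml !linear_sum /= mulr_suml => E.
transitivity (\sum_(p <- sweedler P) slicel mu (p.1 ⊗ p.2 * (1 ⊗ x))).
  by apply: eq_bigr => p _; rewrite tensM !slicelE mulr1 mulrZl.
by rewrite E; apply: eq_bigr => p _; rewrite tensM slicelE mulr1.
Qed.

Lemma NrP_mul_VP (v x : A) : VP P v -> NrP P x -> VP P (x * v).
Proof.
move=> [mu ->] Nx; apply: (VP_intro (f := fun a => mu (S x * a))).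
  by move=> c a b; rewrite mulrDr mulrZr linearP.
have := congr1 (slicel mu) (NrP_shift Nx).
rewrite !comulE !mulr_sumr !linear_sum /= mulr_sumr => E.
transitivity (\sum_(p <- sweedler P) slicel mu ((1 ⊗ x) * (p.1 ⊗ p.2))).
  by apply: eq_bigr => p _; rewrite tensM !slicelE mul1r mulrZr.
by rewrite E; apply: eq_bigr => p _; rewrite tensM slicelE mul1r.
Qed.

Section TwoSided.
Context (SP : S P = P).

(** As [comul P = comul (S P)] is [S P2 ⊗ S P1], its left slices are images
    under [S] of right ones. *)
Lemma comul_in_VP : tensor_set ((fun x : A => S x) @` VP P) (VP P) (comul P).
Proof.
have [s [PE sP]] := tens_slicesP (comul P).
exists s; split=> // p /sP [[nu p1] mu]; split=> //.
exists (\sum_(q <- sweedler P) nu (S q.1) *: q.2).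
  by apply: (VP_intro (f := fun a => nu (S a))) => // c a b; rewrite !linearP.
rewrite p1 -{2}SP comul_antipode !linear_sum /=.
by apply: eq_bigr => q _; rewrite slicerE linearZ.
Qed.

(** [1 = P2 * T P1], and by [comul_in_VP] both [P2] and [T P1] may be taken in
    [VP P], which is contained in [NlP P] and hence absorbs the second factor. *)
Lemma VP1 : VP P 1.
Proof.
have [s [sV PE]] := comul_in_VP.
have := sweedler_antipode_inverse SK TK P.
rewrite counit_grouplike scale1r => <-.
rewrite (sweedler_eq (F := fun a b => b * T a) _ PE); last by solve_bilinear.
rewrite big_seq; elim/big_ind: _ => [||p ps]; [exact: VP0|exact: VPD|].
have [[v Vv <-] Vp] := sV p ps.
by rewrite SK; apply: VP_mul_NlP => //; case: (VP_sub_NP Vv).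
Qed.

Lemma NlP_sub_VP : NlP P `<=` VP P.
Proof. by move=> x Nx; rewrite -[x]mul1r; apply: VP_mul_NlP => //; apply: VP1. Qed.

Lemma NrP_sub_VP : NrP P `<=` VP P.
Proof. by move=> x Nx; rewrite -[x]mulr1; apply: NrP_mul_VP => //; apply: VP1. Qed.

Lemma VP_eq_NP : VP P = NP P.
Proof.
by apply/seteqP; split=> [|x [Nx _]]; [apply: VP_sub_NP|apply: NlP_sub_VP].
Qed.

Lemma NlP_eq_VP : NlP P = VP P.
Proof.
by apply/seteqP; split=> [|x /VP_sub_NP []//]; apply: NlP_sub_VP.
Qed.

Lemma NrP_eq_VP : NrP P = VP P.
Proof.
by apply/seteqP; split=> [|x /VP_sub_NP []//]; apply: NrP_sub_VP.
Qed.

Lemma comul_antipode2 (x : A) :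
  comul (S (S x)) = \sum_(p <- sweedler x) S (S p.1) ⊗ S (S p.2).
Proof.
rewrite comul_antipode.
rewrite (sweedler_eq (F := fun a b => S b ⊗ S a) _ (comul_antipode x)) //.
by solve_bilinear.
Qed.

(** The square of [S] preserves coproducts and fixes [P], so it maps the slice
    of [comul P] by [mu] to the slice by [mu \o T \o T]. *)
Lemma NP_stable : (fun x : A => S (S x)) @` NP P = NP P.
Proof.
have SSP : \sum_(p <- sweedler P) S (S p.1) ⊗ S (S p.2) = comul P.
  by rewrite -comul_antipode2 !SP.
rewrite -VP_eq_NP; apply/seteqP; split=> [_ [_ [mu ->] <-]|_ [mu ->]].
  apply: (VP_intro (f := fun a => mu (T (T a)))).
    by move=> c a b; rewrite !linearP.
  rewrite (sweedler_eq (F := fun a b => mu (T (T a)) *: b) _ (esym SSP)).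
    rewrite comulE !linear_sum /=; apply: eq_bigr => p _.
    by rewrite slicelE !SK !linearZ.
  split=> [v c a b|v c a b] /=; first by rewrite !linearP scalerDl scalerA.
  by rewrite scalerDr !scalerA mulrC.
exists (\sum_(p <- sweedler P) mu (S (S p.1)) *: p.2).
  by apply: (VP_intro (f := fun a => mu (S (S a)))) => // c a b; rewrite !linearP.
rewrite -SSP !linear_sum /=; apply: eq_bigr => p _.
by rewrite slicelE !linearZ.
Qed.
End TwoSided.
End RightGrouplike.
End Antipode.
End Sweedler.

Theorem proposition3p21 (k : fieldType) (A : hopfType k)
    (antipode_bij : bijective (antipode : A -> A))
    (P : A) (P_right : right_grouplike P) :
  [/\ two_sided_grouplike P <-> (fun x : A => antipode (antipode x)) @` NP P = NP P,
      two_sided_grouplike P <->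
        tensor_set ((fun x : A => antipode x) @` NP P) (NP P) (comul P) &
      two_sided_grouplike P ->
        [/\ VP P = NP P, NP P = NlP P & NlP P = NrP P]].
Proof.
case: antipode_bij => g SK TK.
have g_lin : linear g.
  by move=> c x y; rewrite -{1}[x]TK -{1}[y]TK -linearP SK.
pose T : {linear A -> A} :=
  HB.pack g (GRing.isLinear.Build _ _ _ _ _ g_lin).
have tsP := @two_sidedP _ _ T SK TK P P_right.
have SPeq := VP_eq_NP (T := T) SK TK P_right.
split.
- split=> [/tsP SP|stable]; first exact: (NP_stable (T := T)).
  by apply/tsP; apply: (two_sided_of_stable (T := T)).
- split=> [/tsP SP|comulN].
    by rewrite -SPeq //; apply: comul_in_VP.
  by apply/tsP; apply: two_sided_of_comul.
- move=> /tsP SP; rewrite -SPeq // (NlP_eq_VP (T := T)) //.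
  by rewrite (NrP_eq_VP (T := T)).
Qed.
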